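(* The set of strictly regular quadratic bistochastic operators on $S^{m-1}$ is dense in $\mathcal{B}_m$.
   Context: $S^{m-1} = \{x = (x_1, \dots, x_m) \in \mathbb{R}^m : \sum_{i=1}^m x_i = 1,\ x_i \ge 0\}$ is the standard simplex. A quadratic stochastic operator (QSO) is a map $V : S^{m-1} \to S^{m-1}$ of the form $V(x)_k = \sum_{i,j=1}^m p_{ij,k} x_i x_j$ for $k = 1, \dots, m$, where $p_{ij,k} = p_{ji,k} \ge 0$ and $\sum_{r=1}^m p_{ij,r} = 1$ for all $i, j, k \in \{1, \dots, m\}$. A QSO is identified with its (unique) array of coefficients $(p_{ij,k})$, an element of the space $M_m^c(\mathbb{R})$ of real $m \times m \times m$ cubic matrices; the topology on sets of QSOs is that of $M_m^c(\mathbb{R}) \cong \mathbb{R}^{m^3}$. For $x \in S^{m-1}$, let $x_{[1]} \ge \dots \ge x_{[m]}$ be its coordinates in non-increasing order; for $x, y \in S^{m-1}$ write $x \prec y$ if $\sum_{i=1}^k x_{[i]} \le \sum_{i=1}^k y_{[i]}$ for $k = 1, \dots, m-1$. A quadratic bistochastic operator (QBO) is a QSO $V$ with $V(x) \prec x$ for all $x \in S^{m-1}$. $\mathcal{B}_m$ denotes the set of all QBOs on $S^{m-1}$. A QSO $V$ is regular if for every $x \in S^{m-1}$ the trajectory $\{V^n(x)\}_{n \ge 0}$ converges; a regular QSO is strictly regular if it has a unique fixed point. *)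

(* Defs.v *)
From HB Require Import structures.
From mathcomp Require Import all_boot all_order all_algebra.
From mathcomp Require Import all_classical all_reals all_analysis.
From mathcomp Require Import lra.

Set Implicit Arguments.
Unset Strict Implicit.
Unset Printing Implicit Defensive.

Import Order.TTheory GRing.Theory Num.Theory.
Import numFieldNormedType.Exports.

Local Open Scope classical_set_scope.
Local Open Scope ring_scope.

Definition simplex (R : realType) (m : nat) : set 'rV[R]_m :=
  [set x | (forall i, 0 <= x 0 i) /\ \sum_i x 0 i = 1].

(* The entry p_{ij,k} of a cubic matrix is [p i j 0 k]; the topology is the
   canonical one on matrices, i.e. entrywise convergence. *)
Notation cubic R m := 'M['rV[R]_m]_m (only parsing).

Definition qso (R : realType) (m : nat) : set (cubic R m) :=
  [set p : cubic R m | [/\ forall i j k, 0 <= p i j 0 k,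
               forall i j, p i j = p j i &
               forall i j, \sum_r p i j 0 r = 1]].

(* The formula makes sense on all of R^m; the QSO is its restriction to the
   simplex, which it preserves ([qso_op_simplex]) and where it determines the
   coefficients ([qso_op_inj]). *)
Definition qso_op (R : realType) (m : nat) (p : cubic R m) (x : 'rV[R]_m) :
    'rV[R]_m :=
  \row_k \sum_i \sum_j p i j 0 k * x 0 i * x 0 j.

Definition decr_rearr (R : realType) (m : nat) (x : 'rV[R]_m) : seq R :=
  sort >=%R [seq x 0 i | i : 'I_m].

Definition majorized (R : realType) (m : nat) (x y : 'rV[R]_m) : Prop :=
  forall k, (0 < k < m)%N ->
    \sum_(i < k) (decr_rearr x)`_i <= \sum_(i < k) (decr_rearr y)`_i.

Definition qbo (R : realType) (m : nat) : set (cubic R m) :=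
  [set p : cubic R m | qso p /\
           forall x, simplex x -> majorized (qso_op p x) x].

Definition regular_qso (R : realType) (m : nat) : set (cubic R m) :=
  [set p : cubic R m | qso p /\
           forall x, simplex x -> cvgn (fun n => iter n (qso_op p) x)].

Definition strictly_regular_qso (R : realType) (m : nat) : set (cubic R m) :=
  [set p : cubic R m | regular_qso p /\
           exists! x, simplex x /\ qso_op p x = x].

Definition dense_in (T : topologicalType) (B A : set T) : Prop :=
  A `<=` B /\ B `<=` closure A.

Lemma qso_op_simplex (R : realType) (m : nat) (p : cubic R m) (x : 'rV[R]_m) :
  qso p -> simplex x -> simplex (qso_op p x).
Proof.
move=> [p0 _ p1] [x0 x1]; split=> [k|].
  by rewrite mxE sumr_ge0// => i _; rewrite sumr_ge0// => j _; rewrite !mulr_ge0.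
under eq_bigr do rewrite mxE.
rewrite exchange_big /= -[RHS]x1; apply: eq_bigr => i _.
rewrite exchange_big /= -[RHS]mulr1 -x1 mulr_sumr; apply: eq_bigr => j _.
by rewrite -!mulr_suml p1 mul1r.
Qed.

Lemma qso_op_inj (R : realType) (m : nat) (p q : cubic R m) :
  qso p -> qso q ->
  (forall x, simplex x -> qso_op p x = qso_op q x) -> p = q.
Proof.
move=> [_ ps _] [_ qs _] pq.
pose e i j : 'rV[R]_m := 2^-1 *: (delta_mx 0 i + delta_mx 0 j).
have eS i j : simplex (e i j).
  split=> [k|]; first by rewrite !mxE mulr_ge0// addr_ge0.
  under eq_bigr do rewrite !mxE /=.
  rewrite -mulr_sumr big_split /= -!natr_sum.
  by rewrite -!big_mkcond /= !sum1_card !card1; lra.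
have sumE (F : 'I_m -> R) i j :
    \sum_a F a * e i j 0 a = 2^-1 * (F i + F j).
  under eq_bigr do rewrite !mxE /= mulrCA mulrDr.
  rewrite -mulr_sumr big_split /=; congr (_ * (_ + _)).
    rewrite (bigD1 i)//= eqxx mulr1 big1 ?addr0// => a /negbTE ->.
    by rewrite mulr0.
  rewrite (bigD1 j)//= eqxx mulr1 big1 ?addr0// => a /negbTE ->.
  by rewrite mulr0.
have opE (r : cubic R m) i j k : qso_op r (e i j) 0 k =
    2^-1 * (2^-1 * (r i i 0 k + r i j 0 k) + 2^-1 * (r j i 0 k + r j j 0 k)).
  rewrite mxE -(sumE (fun b => r i b 0 k)) -(sumE (fun b => r j b 0 k)).
  rewrite -(sumE (fun a => \sum_b r a b 0 k * e i j 0 b)).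
  apply: eq_bigr => a _; rewrite mulr_suml; apply: eq_bigr => b _.
  by rewrite mulrAC.
have d i k : p i i 0 k = q i i 0 k.
  have := congr1 (fun v : 'rV[R]_m => v 0 k) (pq _ (eS i i)).
  by rewrite /= !opE; lra.
apply/matrixP => i j; apply/rowP => k.
have := congr1 (fun v : 'rV[R]_m => v 0 k) (pq _ (eS i j)).
by rewrite /= !opE (ps j i) (qs j i) !d; lra.
Qed.

(* Main.v *)
Require Import Defs.
From HB Require Import structures.
From mathcomp Require Import all_boot all_order all_algebra.
From mathcomp Require Import all_classical all_reals all_analysis.
From mathcomp Require Import ring lra.

Import Order.TTheory GRing.Theory Num.Theory.
Import numFieldNormedType.Exports.

Local Open Scope classical_set_scope.
Local Open Scope ring_scope.

(** Let c = (1/m, ..., 1/m).  The constant operator with value c is a QBO, since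
    c is majorized by every point of the simplex, so a QBO p can be perturbed to
    (1 - e) p + e c, which acts on the simplex as x |-> (1 - e) p(x) + e c.  The
    sum of the k largest coordinates commutes with such affine maps, so the
    perturbed operator is again a QBO ([damp_qbo]).

    Majorization by x bounds the largest coordinate of p(x) by that of x
    ([majorized_ub]); hence the perturbed operator shrinks the excess of the
    largest coordinate over 1/m by the factor 1 - e < 1.  A point of the simplex
    whose largest coordinate is close to 1/m is close to c
    ([simplex_ub_dist]), so every trajectory converges to c
    ([damp_iter_cvg]).  Since a QBO fixes c, the perturbed operator is strictly
    regular, and it tends to p when e tends to 0 ([damp_ball]). *)

(** * Mixing with the barycenter *)

Definition barycenter (R : realType) (m : nat) : 'rV[R]_m := const_mx m%:R^-1.

Definition damp (R : realType) (m : nat) (e : R) (p : 'M['rV[R]_m]_m) :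
    'M['rV[R]_m]_m :=
  \matrix_(i, j) ((1 - e) *: p i j + e *: barycenter R m).

Lemma barycenter_simplex (R : realType) (m : nat) :
  (0 < m)%N -> simplex (barycenter R m).
Proof.
move=> m0; split=> [i|]; first by rewrite mxE invr_ge0 ler0n.
under eq_bigr do rewrite mxE.
by rewrite sumr_const card_ord -[LHS]mulr_natl divff// pnatr_eq0 -lt0n.
Qed.

Lemma damp_qso (R : realType) (m : nat) (e : R) (p : 'M['rV[R]_m]_m) :
  (0 < m)%N -> 0 <= e <= 1 -> qso p -> qso (damp R m e p).
Proof.
move=> m0 /andP[e0 e1] [p0 ps p1]; split=> [i j k|i j|i j].
- by rewrite !mxE addr_ge0 ?mulr_ge0 ?subr_ge0 ?invr_ge0 ?ler0n.
- by rewrite !mxE ps.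
- under eq_bigr do rewrite mxE 3!mxE.
  rewrite big_split /= -!mulr_sumr p1.
  have [_ ->] := barycenter_simplex R m m0.
  by rewrite !mulr1 subrK.
Qed.

(** The constant coefficients 1/m give a constant operator because the products
    of two coordinates of a point of the simplex sum to 1. *)
Lemma qso_op_damp (R : realType) (m : nat) (e : R) (p : 'M['rV[R]_m]_m) x :
  simplex x ->
  qso_op (damp R m e p) x = (1 - e) *: qso_op p x + e *: barycenter R m.
Proof.
move=> [_ x1]; apply/rowP => k; rewrite !mxE.
have -> : m%:R^-1 = \sum_i \sum_j m%:R^-1 * x 0 i * x 0 j :> R.
  under eq_bigr do rewrite -mulr_sumr x1 mulr1.
  by rewrite -mulr_sumr x1 mulr1.
rewrite !mulr_sumr -big_split /=; apply: eq_bigr => i _.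
rewrite !mulr_sumr -big_split /=; apply: eq_bigr => j _.
rewrite !mxE; ring.
Qed.

(** * Sums of the largest coordinates *)

Lemma size_decr_rearr (R : realType) (m : nat) (x : 'rV[R]_m) :
  size (decr_rearr x) = m.
Proof. by rewrite size_sort size_map size_enum_ord. Qed.

Lemma decr_rearr_sorted (R : realType) (m : nat) (x : 'rV[R]_m) :
  sorted >=%R (decr_rearr x).
Proof. by apply: sort_sorted => a b; exact: le_total. Qed.

Lemma sum_decr_rearr (R : realType) (m : nat) (x : 'rV[R]_m) :
  \sum_(0 <= i < m) (decr_rearr x)`_i = \sum_i x 0 i.
Proof.
rewrite -{1}(size_decr_rearr R m x) -(big_nth 0 xpredT id).
by rewrite (perm_big _ (permEl (perm_sort _ _))) big_map big_enum.
Qed.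

(** A nondecreasing map applied entrywise keeps a nonincreasing sequence
    nonincreasing, and sorted permutations of each other are equal.  This also
    covers [a = 0], where the map is not injective. *)
Lemma decr_rearr_affine (R : realType) (m : nat) (a b : R) (x : 'rV[R]_m) :
  0 <= a ->
  decr_rearr (a *: x + const_mx b) = [seq a * t + b | t <- decr_rearr x].
Proof.
move=> a0; apply: (@sorted_eq _ >=%R).
- by move=> s t u ts su; exact: le_trans su ts.
- by move=> s t; rewrite andbC => /le_anti.
- exact: decr_rearr_sorted.
- rewrite sorted_map; apply: sub_sorted (decr_rearr_sorted R m x) => s t st /=.
  by rewrite lerD2r ler_wpM2l.
- rewrite perm_sort perm_sym.
  rewrite (perm_trans (perm_map _ (permEl (perm_sort _ _))))// -map_comp.
  rewrite (eq_map (g := fun i => (a *: x + const_mx b) 0 i))// => i.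
  by rewrite /= !mxE.
Qed.

Lemma sorted_ge_nth (R : realType) (s : seq R) (i j : nat) :
  sorted >=%R s -> (i <= j < size s)%N -> s`_j <= s`_i.
Proof.
move=> ss /andP[ij js].
have ge_tr : transitive (>=%R : rel R).
  by move=> b a c ab bc; exact: le_trans bc ab.
have ge_refl : reflexive (>=%R : rel R) by move=> a; exact: lexx.
exact: (sorted_leq_nth ge_tr ge_refl 0 ss i j (leq_ltn_trans ij js) js ij).
Qed.

(** The mean of the first [k] terms of a nonincreasing sequence is at least the
    mean of all of them, written without division: the first [k] terms are at
    least the [k]-th, and the remaining ones at most. *)
Lemma sorted_mean_le (R : realType) (s : seq R) (k : nat) :
  sorted >=%R s -> (k <= size s)%N ->
  k%:R * \sum_(0 <= i < size s) s`_i <= (size s)%:R * \sum_(0 <= i < k) s`_i.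
Proof.
case: k => [|k] ss ks; first by rewrite mul0r big_geq// mulr0.
have sle := sorted_ge_nth R s _ _ ss.
rewrite (big_cat_nat (leq0n _) ks)//=.
have lo : k.+1%:R * s`_k <= \sum_(0 <= i < k.+1) s`_i.
  rewrite mulr_natl -{1}(subn0 k.+1) -sumr_const_nat.
  rewrite ler_sum_nat// => i /andP[_ ik]; apply: sle.
  by rewrite -ltnS ik; exact: ks.
have hi : \sum_(k.+1 <= i < size s) s`_i <= ((size s)%:R - k.+1%:R) * s`_k.
  rewrite -natrB// mulr_natl -sumr_const_nat.
  rewrite ler_sum_nat// => i /andP[ki is_]; apply: sle.
  by rewrite (ltnW ki).
have n0 : 0 <= (size s)%:R - k.+1%:R :> R by rewrite subr_ge0 ler_nat.
have k0 : 0 <= k.+1%:R :> R by rewrite ler0n.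
have h1 := ler_wpM2l n0 lo; have h2 := ler_wpM2l k0 hi.
move: h1 h2; lra.
Qed.

Lemma barycenter_majorized (R : realType) (m : nat) (x : 'rV[R]_m) :
  simplex x -> majorized (barycenter R m) x.
Proof.
move=> [_ x1] k /andP[k0 km].
have m0 : (0 < m%:R :> R) by rewrite ltr0n (ltn_trans k0).
have -> : barycenter R m = 0 *: x + const_mx m%:R^-1 by rewrite scale0r add0r.
rewrite decr_rearr_affine//.
under eq_bigr => i _.
  rewrite (nth_map 0) ?size_decr_rearr ?(ltn_trans (ltn_ord i))// mul0r add0r.
  over.
rewrite sumr_const card_ord -[leLHS]mulr_natl ler_pdivrMr//.
have := @sorted_mean_le R _ k (decr_rearr_sorted R m x).
rewrite size_decr_rearr sum_decr_rearr x1 mulr1 big_mkord mulrC; apply.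
exact: ltnW.
Qed.

(** Both [y] and the barycenter are majorized by [x], and adding the constant
    vector [e / m] to a nonnegative multiple of [y] does not change the order
    of its coordinates, so the two families of inequalities can be averaged. *)
Lemma majorized_mix (R : realType) (m : nat) (e : R) (x y : 'rV[R]_m) :
  0 <= e <= 1 -> simplex x -> majorized y x ->
  majorized ((1 - e) *: y + e *: barycenter R m) x.
Proof.
move=> /andP[e0 e1] xS yx k km; have bx := barycenter_majorized R m x xS k km.
have /andP[k0 km'] := km.
have b0 : 0 <= 1 - e by rewrite subr_ge0.
have -> : e *: barycenter R m = const_mx (e * m%:R^-1).
  by apply/rowP => i; rewrite !mxE.
move: bx; have -> : barycenter R m = 0 *: y + const_mx m%:R^-1.
  by rewrite scale0r add0r.
rewrite !decr_rearr_affine//.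
under eq_bigr => i _.
  rewrite (nth_map 0) ?size_decr_rearr ?(ltn_trans (ltn_ord i))// mul0r add0r.
  over.
rewrite sumr_const card_ord => bx.
under eq_bigr => i _.
  rewrite (nth_map 0) ?size_decr_rearr ?(ltn_trans (ltn_ord i))//.
  over.
rewrite big_split /= -mulr_sumr sumr_const card_ord -mulrnAr.
have := lerD (ler_wpM2l b0 (yx k km)) (ler_wpM2l e0 bx).
by rewrite -mulrDl subrK mul1r.
Qed.

(** The partial sums with [k = 1] compare the largest coordinates.  When
    [m = 1] majorization is an empty condition, but then the simplex is a
    single point. *)
Lemma majorized_ub (R : realType) (m : nat) (x y : 'rV[R]_m) (b : R) :
  simplex x -> simplex y -> majorized y x ->
  (forall i, x 0 i <= b) -> forall i, y 0 i <= b.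
Proof.
move=> [_ x1] [_ y1] yx xb i.
case: m => [|[|m]] in x y x1 y1 yx xb i *.
- by case: i.
- by have := xb i; move: x1 y1; rewrite !big_ord1 !ord1 => -> ->.
have := yx 1%N isT; rewrite !big_ord1 => h.
have yi : y 0 i <= (decr_rearr y)`_0.
  have : y 0 i \in decr_rearr y by rewrite mem_sort map_f// mem_enum.
  case/(nthP 0) => j js <-.
  by apply: (sorted_ge_nth _ _ _ _ (decr_rearr_sorted R _ y)); rewrite leq0n.
have x0 : (decr_rearr x)`_0 <= b.
  have : (decr_rearr x)`_0 \in decr_rearr x by rewrite mem_nth ?size_decr_rearr.
  by rewrite mem_sort => /mapP[j _ ->].
exact: le_trans yi (le_trans h x0).
Qed.

(** The deficits [m^-1 + d - x_j] are nonnegative and sum to [m d], so each of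
    them is at most [m d]: an upper bound on all the coordinates forces a
    lower bound as well. *)
Lemma simplex_ub_dist (R : realType) (m : nat) (x : 'rV[R]_m) (d : R) :
  (0 < m)%N -> simplex x -> 0 <= d -> (forall i, x 0 i <= m%:R^-1 + d) ->
  forall i, `|barycenter R m 0 i - x 0 i| <= m%:R * d.
Proof.
move=> m0 [_ x1] d0 xd i; rewrite mxE.
have S : \sum_j (m%:R^-1 + d - x 0 j) = m%:R * d.
  rewrite sumrB x1 sumr_const card_ord -[X in X - _]mulr_natl mulrDr.
  rewrite divff ?pnatr_eq0 -?lt0n//.
  ring.
have h : m%:R^-1 + d - x 0 i <= m%:R * d.
  rewrite -S (bigD1 i)//= lerDl sumr_ge0// => j _; by rewrite subr_ge0.
have dm : d <= m%:R * d by rewrite ler_peMl// ler1n.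
have := xd i; rewrite ler_norml; lra.
Qed.

(** * Dynamics of the damped operator *)

(** The image of the barycenter has no coordinate above [m^-1], and the
    barycenter is the only such point of the simplex. *)
Lemma qbo_fix_barycenter (R : realType) (m : nat) (p : 'M['rV[R]_m]_m) :
  (0 < m)%N -> qbo p -> qso_op p (barycenter R m) = barycenter R m.
Proof.
move=> m0 [pq pm]; have cS := barycenter_simplex R m m0.
have VS := qso_op_simplex pq cS.
apply/rowP => i.
have ub j : qso_op p (barycenter R m) 0 j <= m%:R^-1 + 0.
  by apply: (majorized_ub _ _ _ _ _ cS VS (pm _ cS)) => k; rewrite mxE addr0.
have := simplex_ub_dist R m _ 0 m0 VS (lexx 0) ub i.
by rewrite mulr0 normr_le0 subr_eq0 => /eqP.
Qed.

Lemma damp_qbo (R : realType) (m : nat) (e : R) (p : 'M['rV[R]_m]_m) :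
  (0 < m)%N -> 0 <= e <= 1 -> qbo p -> qbo (damp R m e p).
Proof.
move=> m0 e01 [pq pm]; split; first exact: damp_qso.
move=> x xS; rewrite qso_op_damp//; apply: majorized_mix => //; exact: pm.
Qed.

Lemma iter_qso_op_simplex (R : realType) (m : nat) (p : 'M['rV[R]_m]_m) x n :
  qso p -> simplex x -> simplex (iter n (qso_op p) x).
Proof. by move=> pq xS; elim: n => //= n; exact: qso_op_simplex. Qed.

(** The excess over [m^-1] is at most 1 at the start, and each step multiplies
    this bound by [1 - e] because [p] itself does not increase the largest
    coordinate. *)
Lemma damp_iter_ub (R : realType) (m : nat) (e : R) (p : 'M['rV[R]_m]_m) x n :
  (0 < m)%N -> 0 <= e <= 1 -> qbo p -> simplex x -> forall i,
  iter n (qso_op (damp R m e p)) x 0 i <= m%:R^-1 + (1 - e) ^+ n.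
Proof.
move=> m0 e01 pB xS; have [pq pm] := pB.
have b0 : 0 <= 1 - e by rewrite subr_ge0; case/andP: e01.
elim: n => [|n IH] i.
  rewrite expr0 /=; have [x0 x1] := xS.
  apply: (@le_trans _ _ 1); last by rewrite lerDr invr_ge0 ler0n.
  by rewrite -x1 (bigD1 i)//= lerDl sumr_ge0.
rewrite iterS; set y := iter n _ x in IH *.
have yS : simplex y by apply: iter_qso_op_simplex => //; exact: damp_qso.
rewrite qso_op_damp// !mxE -[X in X <= _]/(_ + _).
have := majorized_ub _ _ _ _ _ yS (qso_op_simplex pq yS) (pm _ yS) IH i.
rewrite mxE => /(ler_wpM2l b0); rewrite exprS; lra.
Qed.

Lemma damp_iter_cvg (R : realType) (m : nat) (e : R) (p : 'M['rV[R]_m]_m) x :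
  (0 < m)%N -> 0 < e <= 1 -> qbo p -> simplex x ->
  iter n (qso_op (damp R m e p)) x @[n --> \oo] --> barycenter R m.
Proof.
move=> m0 /andP[e0 e1] pB xS.
have e01 : 0 <= e <= 1 by rewrite ltW.
have b0 : 0 <= 1 - e by rewrite subr_ge0.
have : m%:R * (1 - e) ^+ n @[n --> \oo] --> m%:R * (0 : R).
  apply: cvgMr; apply: cvg_expr; rewrite ger0_norm//; lra.
rewrite mulr0 => /cvgr0_norm_lt g.
apply/cvg_ballP => d d0; near=> n.
split=> // i j; rewrite ord1 /ball /=.
apply: (@le_lt_trans _ _ (m%:R * (1 - e) ^+ n)).
  apply: simplex_ub_dist => //.
  - apply: iter_qso_op_simplex => //; apply: damp_qso => //; by case: pB.
  - exact: exprn_ge0.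
  - exact: damp_iter_ub.
apply: le_lt_trans (ler_norm _) _.
by near: n; exact: g.
Unshelve. all: by end_near. Qed.

Lemma damp_strictly_regular (R : realType) (m : nat) (e : R)
    (p : 'M['rV[R]_m]_m) :
  (0 < m)%N -> 0 < e <= 1 -> qbo p -> strictly_regular_qso (damp R m e p).
Proof.
move=> m0 e01 pB.
have e01' : 0 <= e <= 1 by case/andP: e01 => e0 ->; rewrite ltW.
have qB := damp_qbo R m e p m0 e01' pB; have [qQ _] := qB.
split.
  split=> // x xS; apply/cvg_ex; exists (barycenter R m); exact: damp_iter_cvg.
exists (barycenter R m); split.
  by split; [exact: barycenter_simplex|exact: qbo_fix_barycenter].
move=> y [yS yf].
have := damp_iter_cvg R m e p y m0 e01 pB yS.
have -> : (fun n => iter n (qso_op (damp R m e p)) y) = fun=> y.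
  by apply/funext; elim=> //= n ->.
move=> h; exact: (cvg_unique (@norm_hausdorff _ _) h (cvg_cst y)).
Qed.

(** Each coefficient moves by [e |p_ijk - m^-1| <= e], so any [e < d] in the
    interval (0, 1] would do; [d / (d + 1)] meets both bounds. *)
Lemma damp_ball (R : realType) (m : nat) (d : R) (p : 'M['rV[R]_m]_m) :
  0 < d -> qso p -> ball p d (damp R m (d / (d + 1)) p).
Proof.
move=> d0 [p0 _ p1]; split=> // i j; split=> // i' k; rewrite ord1 /ball /=.
have pk1 : p i j 0 k <= 1.
  by rewrite -(p1 i j) (bigD1 k)//= lerDl sumr_ge0.
have c0 : 0 <= m%:R^-1 :> R by rewrite invr_ge0 ler0n.
have c1 : m%:R^-1 <= 1 :> R.
  by rewrite invf_le1 ?ler1n ?ltr0n (leq_ltn_trans _ (ltn_ord k)).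
have e0 : 0 < d / (d + 1) by rewrite divr_gt0// addr_gt0.
have ed : d / (d + 1) < d.
  by rewrite ltr_pdivrMr ?addr_gt0// ltr_pMr// ltrDr.
apply: le_lt_trans ed; rewrite !mxE.
set e := d / _ in e0 *.
rewrite (_ : _ - _ = e * (p i j 0 k - m%:R^-1)); last by ring.
rewrite normrM gtr0_norm// ler_piMr ?(ltW e0)// ler_norml.
have := p0 i j k; lra.
Qed.

Theorem corollary3p3 (R : realType) (m : nat) (m_gt0 : (0 < m)%N) :
  dense_in (@qbo R m) (@qbo R m `&` @strictly_regular_qso R m).
Proof.
split=> [p []//|p pB U /nbhs_ballP[d /= d0 pU]].
have e01 : 0 < d / (d + 1) <= 1.
  by rewrite divr_gt0 ?addr_gt0//= ler_pdivrMr ?addr_gt0// mul1r lerDl.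
exists (damp R m (d / (d + 1)) p); split; last first.
  by apply/pU/damp_ball => //; case: pB.
split; last exact: damp_strictly_regular.
by apply: damp_qbo => //; case/andP: e01 => /ltW ->.
Qed.
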